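(* Let $H$ be a separable Hilbert space, $G=(g_n)_{n=1}^\infty$ a frame for $H$, $G^d=(g_n^d)_{n=1}^\infty$ a dual frame of $G$, and $\mu_k(x)=(1+|x|)^k$, $k\in\mathbb N_0$. Let $\Theta_k=\ell^2_{\mu_k}$, $\Theta_F=\bigcap_{k\in\mathbb N_0}\Theta_k$, $X_k=H^{\Theta_k}_{G,G^d}$, $X_F=\bigcap_{k\in\mathbb N_0}X_k$, and $M=\{(\langle f,g_n^d\rangle)_{n=1}^\infty : f\in H\}$. Assume that for every $k\in\mathbb N$, $M\cap\Theta_k\ne\{0\}$ and $M\cap\Theta_F$ is dense in $M\cap\Theta_k$ with respect to the norm of $\Theta_k$. Let $E=(e_n)_{n=1}^\infty$ be a sequence with elements from $X_F$ which is a frame for $H$. Then the following hold. (i) Assume that there exist $s_0\in\mathbb N$, $C>0$ and for every $k\in\mathbb N$ there exists $C_k>0$ such that $$|\langle e_m,g_n\rangle|\le\begin{cases} C n^{s_0}, & n>m,\\ C_k n^k m^{-k}, & n\le m.\end{cases}$$ Then the analysis operator $U_E: f\mapsto(\langle f,e_m\rangle)_{m=1}^\infty$ is continuous from $X_F$ into $\mathbf s$. (ii) Assume that there exist $\widetilde s_0\in\mathbb N_0$, $\widetilde C>0$ and for every $k\in\mathbb N$ there exists $\widetilde C_k>0$ such that $$|\langle e_m,g^d_n\rangle|\le\begin{cases}\widetilde C m^{\widetilde s_0}, & m>n,\\ \widetilde C_k m^k n^{-k}, & m\le n.\end{cases}$$ Then the synthesis operator $T_E:(c_n)_{n=1}^\infty\mapsto\sum_{n=1}^\infty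 c_ne_n$ is continuous from $\mathbf s$ into $X_F$. (iii) Under the assumptions of (i) and (ii), the frame operator $T_EU_E$ is continuous from $X_F$ into $X_F$.
   Context: $\mathbb N=\{1,2,\dots\}$, $\mathbb N_0=\mathbb N\cup\{0\}$. A frame for $H$ is a sequence $(g_n)$ in $H$ with $A\|f\|^2\le\sum_n|\langle f,g_n\rangle|^2\le B\|f\|^2$ for all $f\in H$ and some constants $A,B>0$. A dual frame of $(g_n)$ is a frame $(g_n^d)$ for $H$ with $f=\sum_n\langle f,g_n^d\rangle g_n=\sum_n\langle f,g_n\rangle g_n^d$ for all $f\in H$. $\ell^2_\mu$ is the space of complex sequences $(a_n)_{n=1}^\infty$ with norm $(\sum_{n=1}^\infty|a_n|^2\mu(n)^2)^{1/2}<\infty$. For a Banach sequence space $\Theta$ with continuous coordinate functionals, $H^{\Theta}_{G,G^d}$ is the Banach space of all $f\in H$ with $(\langle f,g_n^d\rangle)_{n=1}^\infty\in\Theta$, normed by $\|f\|=\|(\langle f,g_n^d\rangle)_n\|_\Theta$. $X_F$ carries the Fréchet topology given by the norms of $X_k$, $k\in\mathbb N_0$. $\mathbf s$ is the Fréchet space of complex sequences with $\sup_n|a_n|n^k<\infty$ for all $k\in\mathbb N_0$ (equivalently, here, $\mathbf s=\Theta_F$), topologized by these norms. *)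

(* Defs.v *)
From HB Require Import structures.
From mathcomp Require Import all_boot all_order all_algebra.
From mathcomp Require Import all_classical all_reals all_analysis.
From mathcomp Require Import complex.

Set Implicit Arguments.
Unset Strict Implicit.
Unset Printing Implicit Defensive.

Import Order.TTheory GRing.Theory Num.Theory.
Import numFieldNormedType.Exports.

Local Open Scope classical_set_scope.
Local Open Scope ring_scope.

(* Sequences are indexed from 0: the entry of index n stands for the entry of
   index n.+1 of a sequence indexed by {1, 2, ...}, so every weight or power
   of the index is taken at n.+1. *)

(* The norm of a module over R[i] takes its values in R[i]. *)
Definition rnorm (R : realType) (H : normedModType R[i]) (f : H) : R :=
  complex.Re `|f|.

Definition cmod (R : realType) (z : R[i]) : R := ComplexField.Normc.normc z.

(* The subspace D of V with the topology generated by the (semi)norms p k: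
   the balls of finitely many p k of common radius form a basis of
   neighbourhoods of each point. The type is a copy of the subset type of D,
   kept apart from it so that any topology that D has as a subspace of V plays
   no role. *)
Definition seminormed (R : realType) (V : zmodType) (D : set V)
  (p : nat -> V -> R) : Type := {x : V | x \in D}.

Section SeminormTopology.
Context {R : realType} {V : zmodType} (D : set V) (p : nat -> V -> R).

Local Notation S := (seminormed D p).

HB.instance Definition _ := gen_eqMixin S.
HB.instance Definition _ := gen_choiceMixin S.

Definition seminorm_nbh (x : S) (n : nat) (eps : R) : set S :=
  [set y | forall k, (k <= n)%N -> p k (sval y - sval x) < eps].

Definition seminorm_open : set_system S :=
  [set U | forall x, U x ->
    exists n, exists2 eps : R, 0 < eps & seminorm_nbh x n eps `<=` U].

Let seminorm_openT : seminorm_open setT.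
Proof. by move=> x _; exists 0, 1. Qed.

Let seminorm_openI : setI_closed seminorm_open.
Proof.
move=> A B oA oB x [/oA[n [e e0 nA]] /oB[m [d d0 mB]]].
exists (maxn n m), (Num.min e d); first by rewrite lt_min e0 d0.
move=> y yx; split.
- apply: nA => k kn; have := yx k; rewrite lt_min => /(_ _)/andP[]//.
  by rewrite leq_max kn.
- apply: mB => k km; have := yx k; rewrite lt_min => /(_ _)/andP[]//.
  by rewrite leq_max km orbT.
Qed.

Let seminorm_open_bigU (I : Type) (f : I -> set S) :
  (forall i, seminorm_open (f i)) -> seminorm_open (\bigcup_i f i).
Proof.
move=> of_ x [i _ fix_]; have [n [e e0 nf]] := of_ i x fix_.
by exists n, e => // y /nf fiy; exists i.
Qed.

HB.instance Definition _ := isOpenTopological.Build S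
  seminorm_openT seminorm_openI seminorm_open_bigU.

End SeminormTopology.

(* T maps D1 into D2, and is continuous for the topologies given by the
   families of norms p1 and p2. *)
Definition continuous_from_into (R : realType) (V1 V2 : zmodType)
    (D1 : set V1) (p1 : nat -> V1 -> R) (D2 : set V2) (p2 : nat -> V2 -> R)
    (T : V1 -> V2) : Prop :=
  exists F : seminormed D1 p1 -> seminormed D2 p2,
    (forall x, sval (F x) = T (sval x)) /\ continuous F.

Section SequenceSpaces.
Context {R : realType}.

Definition ell2_sum (mu : R -> R) (a : nat -> R[i]) : \bar R :=
  (\sum_(0 <= n <oo) (cmod (a n) ^+ 2 * mu n.+1%:R ^+ 2)%:E)%E.

Definition ell2 (mu : R -> R) : set (nat -> R[i]) :=
  [set a | (ell2_sum mu a < +oo)%E].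

Definition ell2_norm (mu : R -> R) (a : nat -> R[i]) : R :=
  Num.sqrt (fine (ell2_sum mu a)).

Definition weight (k : nat) (x : R) : R := (1 + `|x|) ^+ k.

Definition Theta (k : nat) : set (nat -> R[i]) := ell2 (weight k).

Definition Theta_norm (k : nat) : (nat -> R[i]) -> R := ell2_norm (weight k).

Definition Theta_F : set (nat -> R[i]) := \bigcap_k Theta k.

Definition s_values (k : nat) (a : nat -> R[i]) : set R :=
  range (fun n => cmod (a n) * n.+1%:R ^+ k).

Definition s_space : set (nat -> R[i]) :=
  [set a | forall k, has_ubound (s_values k a)].

Definition s_norm (k : nat) (a : nat -> R[i]) : R := sup (s_values k a).

End SequenceSpaces.

Section Frames.
Context {R : realType} {H : completeNormedModType R[i]}.
Variable ip : {dot H for conjc}.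

Definition is_frame (g : nat -> H) : Prop :=
  exists A B : R, [/\ 0 < A, 0 < B & forall f : H,
    ((A * rnorm f ^+ 2)%:E <= \sum_(0 <= n <oo) (cmod (ip f (g n)) ^+ 2)%:E
      <= (B * rnorm f ^+ 2)%:E)%E].

Definition is_dual_frame (g gd : nat -> H) : Prop :=
  is_frame gd /\ forall f : H,
    series (fun n => ip f (gd n) *: g n) @ \oo --> f /\
    series (fun n => ip f (g n) *: gd n) @ \oo --> f.

Definition analysis_op (e : nat -> H) (f : H) : nat -> R[i] :=
  fun n => ip f (e n).

Definition synthesis_op (e : nat -> H) (c : nat -> R[i]) : H :=
  limn (series (fun n => c n *: e n)).

Definition frame_op (e : nat -> H) (f : H) : H :=
  synthesis_op e (analysis_op e f).

(* The space of f whose coefficients with respect to the dual frame gd lie in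
   the sequence space T of norm N. *)
Definition coef_space (gd : nat -> H) (T : set (nat -> R[i])) : set H :=
  [set f | T (analysis_op gd f)].

Definition coef_norm (gd : nat -> H) (N : (nat -> R[i]) -> R) (f : H) : R :=
  N (analysis_op gd f).

Definition X (gd : nat -> H) (k : nat) : set H := coef_space gd (Theta k).

Definition X_norm (gd : nat -> H) (k : nat) : H -> R :=
  coef_norm gd (Theta_norm k).

Definition X_F (gd : nat -> H) : set H := \bigcap_k X gd k.

Definition coef_range (gd : nat -> H) : set (nat -> R[i]) :=
  range (analysis_op gd).

Definition analysis_decay (g e : nat -> H) : Prop :=
  exists (s0 : nat) (C : R), [/\ (0 < s0)%N, 0 < C,
    (forall m n, (m < n)%N -> cmod (ip (e m) (g n)) <= C * n.+1%:R ^+ s0) &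
    forall k, (0 < k)%N -> exists2 Ck : R, 0 < Ck & forall m n, (n <= m)%N ->
      cmod (ip (e m) (g n)) <= Ck * n.+1%:R ^+ k * m.+1%:R ^- k].

Definition synthesis_decay (gd e : nat -> H) : Prop :=
  exists (s0 : nat) (C : R), [/\ 0 < C,
    (forall m n, (n < m)%N -> cmod (ip (e m) (gd n)) <= C * m.+1%:R ^+ s0) &
    forall k, (0 < k)%N -> exists2 Ck : R, 0 < Ck & forall m n, (m <= n)%N ->
      cmod (ip (e m) (gd n)) <= Ck * m.+1%:R ^+ k * n.+1%:R ^- k].

End Frames.

(* Main.v *)
(* All estimates are suprema of |a_n| n^k: since sum 1/n^2 <= 2, the norm of
   Theta_k is controlled by sup |a_n| n^(k+1) and controls sup |a_n| n^k, so
   Theta_F = s with equivalent families of norms. Either decay condition gives,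
   for every k, some p and D with |w_(m,n)| m^k <= D n^p, where w is the matrix of
   the operator. Expanding f = sum <f, gd_n> g_n, resp. sum c_m e_m, inside the
   inner product and pairing |a_n| n^(p+2) <= B with |w_(m,n)| <= D m^(-k) n^p
   bounds the m-th coefficient of the image by 2 B D m^(-k). *)

Require Import Defs.
From mathcomp Require Import all_boot all_order all_algebra.
From mathcomp Require Import all_classical all_reals all_analysis.
From mathcomp Require Import complex.
From mathcomp Require Import ring lra.

Set Implicit Arguments.
Unset Strict Implicit.
Unset Printing Implicit Defensive.

Import Order.TTheory GRing.Theory Num.Theory.
Import numFieldNormedType.Exports.

Local Open Scope classical_set_scope.
Local Open Scope ring_scope.

(** * The complex modulus *)

Section Modulus.
Context {R : realType}.
Implicit Types z w : R[i].

Lemma cmod_ge0 z : 0 <= cmod z.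
Proof. by case: z => a b; exact: sqrtr_ge0. Qed.

Lemma cmodM z w : cmod (z * w) = cmod z * cmod w.
Proof. exact: ComplexField.Normc.normcM. Qed.

Lemma cmodJ z : cmod (conjc z) = cmod z.
Proof. by case: z => a b; rewrite /cmod /= sqrrN. Qed.

Lemma normr_cmod z : `|z| = (cmod z)%:C%C.
Proof. by []. Qed.

Lemma cmodD z w : cmod (z + w) <= cmod z + cmod w.
Proof. by rewrite -lecR rmorphD/=; exact: (@ler_normD _ R[i]). Qed.

Lemma cmodN z : cmod (- z) = cmod z.
Proof. by case: z => a b; rewrite /cmod /= !sqrrN. Qed.

Lemma cmodB z w : cmod (z - w) <= cmod z + cmod w.
Proof. by rewrite -(cmodN w); exact: cmodD. Qed.

Lemma cmod0 : cmod (0 : R[i]) = 0.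
Proof. exact: ComplexField.Normc.normc0. Qed.

Lemma cmod_sum (F : nat -> R[i]) m n :
  cmod (\sum_(m <= i < n) F i) <= \sum_(m <= i < n) cmod (F i).
Proof.
elim/big_ind2: _ => [|x1 x2 y1 y2 h1 h2|//]; first by rewrite cmod0.
by rewrite (le_trans (cmodD _ _))// lerD.
Qed.

End Modulus.

(** * Rapidly decreasing sequences and matrices, and weighted square sums *)

Section Decay.
Context {R : realType}.
Implicit Types (a : nat -> R[i]) (B D : R).

(* [1/(i+1)^2 <= 2/(i+1) - 2/(i+2)], which telescopes. *)
Lemma sum_invsqr_le m n :
  \sum_(m <= i < n) (i.+1%:R ^- 2 : R) <= 2 / m.+1%:R.
Proof.
have [mn|nm] := leqP m n; last first.
  by rewrite big_geq ?(ltnW nm)// divr_ge0.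
have h i : i.+1%:R ^- 2 <= (- (2 / i.+2%:R)) - (- (2 / i.+1%:R)) :> R.
  rewrite opprK addrC -[i.+2]addn1 natrD.
  have : 1 <= i.+1%:R :> R by rewrite ler1n.
  move: (i.+1%:R : R) => x x1; have x0 : 0 < x by exact: lt_le_trans x1.
  have -> : 2 / x - 2 / (x + 1) = 2 / (x * (x + 1)).
    by field; rewrite !gt_eqF ?addr_gt0.
  rewrite -div1r ler_pdivrMr ?exprn_gt0// mulrAC.
  by rewrite ler_pdivlMr ?mulr_gt0 ?addr_gt0//; nra.
apply: (le_trans (ler_sum _ (fun i _ => h i))).
rewrite telescope_sumr// opprK gerDr oppr_le0.
by rewrite divr_ge0.
Qed.

Lemma decay_summand_le (x y B D : R) p n : 0 <= x -> 0 <= y ->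
  x * n.+1%:R ^+ p.+2 <= B -> y <= D * n.+1%:R ^+ p ->
  x * y <= B * D * n.+1%:R ^- 2.
Proof.
move=> x0 y0 xB yD; rewrite ler_pdivlMr ?exprn_gt0//.
have n0 : 0 < n.+1%:R ^+ p :> R by rewrite exprn_gt0.
(* The sign of [D] is forced by [0 <= y] and the bound on [y]. *)
have D0 : 0 <= D by rewrite -(pmulr_lge0 _ n0) (le_trans y0 yD).
apply: (@le_trans _ _ (x * (D * n.+1%:R ^+ p) * n.+1%:R ^+ 2)).
  by rewrite ler_wpM2r ?exprn_ge0// ler_wpM2l.
rewrite (_ : _ * _ = (x * n.+1%:R ^+ p.+2) * D); first by rewrite ler_wpM2r.
by rewrite -[p.+2]addn2 exprD; ring.
Qed.

Lemma pairing_le a (w : nat -> R[i]) p B D m n : 0 <= B -> 0 <= D ->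
  (forall i, cmod (a i) * i.+1%:R ^+ p.+2 <= B) ->
  (forall i, cmod (w i) <= D * i.+1%:R ^+ p) ->
  cmod (\sum_(m <= i < n) a i * w i) <= B * D * (2 / m.+1%:R).
Proof.
move=> B0 D0 aB wD; rewrite (le_trans (cmod_sum _ _ _))//.
apply: (@le_trans _ _ (\sum_(m <= i < n) (B * D * i.+1%:R ^- 2))).
  apply: ler_sum => i _; rewrite cmodM.
  by apply: (@decay_summand_le _ _ _ _ p); rewrite ?cmod_ge0.
by rewrite -mulr_sumr ler_wpM2l ?mulr_ge0// sum_invsqr_le.
Qed.

Lemma weight_natS_ge k n : n.+1%:R ^+ k <= weight k n.+1%:R :> R.
Proof. by rewrite /weight lerXn2r ?nnegrE ?addr_ge0// ger0_norm// lerDr. Qed.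

Lemma weight_natS_le k n : weight k n.+1%:R <= 2 ^+ k * n.+1%:R ^+ k :> R.
Proof.
rewrite /weight -exprMn lerXn2r ?nnegrE ?addr_ge0 ?mulr_ge0// ger0_norm//.
by rewrite mulr_natl mulr2n lerD2r ler1n.
Qed.

Lemma ell2_sum_ge0 (mu : R -> R) a : (0 <= ell2_sum mu a)%E.
Proof.
by apply: nneseries_ge0 => n _ _; rewrite lee_fin mulr_ge0// sqr_ge0.
Qed.

Lemma ell2_coef_le (mu : R -> R) a n : ell2 mu a ->
  cmod (a n) * mu n.+1%:R <= ell2_norm mu a.
Proof.
rewrite /ell2 /= => afin.
(* The sign of [mu] is arbitrary: where it is negative the left side is at most 0. *)
have [mn|mn] := leP 0 (mu n.+1%:R); last first.
  by rewrite (@le_trans _ _ 0) ?sqrtr_ge0// mulr_ge0_le0 ?cmod_ge0// ltW.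
have am0 : 0 <= cmod (a n) * mu n.+1%:R by rewrite mulr_ge0 ?cmod_ge0.
rewrite -(ger0_norm am0) -sqrtr_sqr ler_wsqrtr// -lee_fin fineK; last first.
  by rewrite ge0_fin_numE// ell2_sum_ge0.
have pos i : (0 <= (cmod (a i) ^+ 2 * mu i.+1%:R ^+ 2)%:E)%E.
  by rewrite lee_fin mulr_ge0// sqr_ge0.
(* The square of one term is at most the partial sum that ends with it, hence at most the whole
   series. *)
have := @nneseries_lim_ge _ _ predT 0%N n.+1 (fun i _ _ => pos i).
apply: le_trans; rewrite big_nat_recr//= exprMn leeDr// sume_ge0//.
Qed.

Lemma Theta_coef_le k a n : Theta k a ->
  cmod (a n) * n.+1%:R ^+ k <= Theta_norm k a.
Proof.
move=> /ell2_coef_le => /(_ n); apply: le_trans.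
by rewrite ler_wpM2l ?cmod_ge0// weight_natS_ge.
Qed.

(** The spare power of the index leaves squared terms of size (n+1)^(-2). The factor 2^k comes from
    1 + x <= 2x for x >= 1; the sum of the inverse squares is at most 2, and its square root is
    rounded up to the last factor 2. *)
Lemma decay_Theta k a B : (forall n, cmod (a n) * n.+1%:R ^+ k.+1 <= B) ->
  Theta k a /\ Theta_norm k a <= 2 ^+ k.+1 * B.
Proof.
move=> aB.
have B0 : 0 <= B.
  by apply: le_trans (aB 0%N); rewrite mulr_ge0 ?cmod_ge0 ?exprn_ge0.
have K0 : 0 <= (2 ^+ k * B) ^+ 2 by rewrite sqr_ge0.
have le n : cmod (a n) ^+ 2 * weight k n.+1%:R ^+ 2
    <= (2 ^+ k * B) ^+ 2 * n.+1%:R ^- 2.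
  rewrite ler_pdivlMr ?exprn_gt0// -!exprMn lerXn2r ?nnegrE//.
  - by rewrite !mulr_ge0 ?cmod_ge0 ?exprn_ge0 ?addr_ge0.
  - by rewrite mulr_ge0 ?exprn_ge0.
  apply: (@le_trans _ _ (2 ^+ k * (cmod (a n) * n.+1%:R ^+ k.+1))).
    rewrite exprSr !mulrA ler_wpM2r// [2 ^+ k * _]mulrC -mulrA.
    by rewrite ler_wpM2l ?cmod_ge0 ?weight_natS_le.
  by rewrite ler_wpM2l ?exprn_ge0.
have sle : (ell2_sum (weight k) a <= ((2 ^+ k.+1 * B) ^+ 2)%:E)%E.
  apply: lime_le.
    by apply: is_cvg_nneseries => n _ _; rewrite lee_fin mulr_ge0// sqr_ge0.
  apply: nearW => n; rewrite sumEFin lee_fin.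
  rewrite (le_trans (ler_sum _ (fun i _ => le i)))// -mulr_sumr.
  apply: (@le_trans _ _ ((2 ^+ k * B) ^+ 2 * 2)).
    by rewrite ler_wpM2l// (le_trans (sum_invsqr_le _ _))// divr1.
  have -> : 2 ^+ k.+1 * B = 2 * (2 ^+ k * B) by rewrite exprS mulrA.
  by rewrite [leRHS]exprMn; move: ((2 ^+ k * B) ^+ 2) K0 => K K0; lra.
have afin : Theta k a by apply: (le_lt_trans sle); rewrite ltry.
split=> //; have C0 : 0 <= 2 ^+ k.+1 * B by rewrite mulr_ge0 ?exprn_ge0.
rewrite -(ger0_norm C0) -sqrtr_sqr ler_wsqrtr// -lee_fin fineK//.
by rewrite ge0_fin_numE// ell2_sum_ge0.
Qed.

Lemma s_coef_le k a n : s_space a -> cmod (a n) * n.+1%:R ^+ k <= s_norm k a.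
Proof. by move=> /(_ k) ub; apply: (ub_le_sup ub); exists n. Qed.

Lemma s_norm_ge0 k a : s_space a -> 0 <= s_norm k a.
Proof.
move=> sa; apply: le_trans (s_coef_le k 0 sa).
by rewrite mulr_ge0 ?cmod_ge0 ?exprn_ge0.
Qed.

Lemma s_norm_le k a B : (forall n, cmod (a n) * n.+1%:R ^+ k <= B) ->
  s_norm k a <= B.
Proof.
move=> aB; apply: ge_sup.
  by exists (cmod (a 0%N) * 1%:R ^+ k); exists 0%N.
by move=> _ [n _ <-].
Qed.

Lemma decay_s_space a :
  (forall k, exists B, forall n, cmod (a n) * n.+1%:R ^+ k <= B) -> s_space a.
Proof. by move=> h k; have [B aB] := h k; exists B => _ [n _ <-]. Qed.

Lemma Theta_F_s_space : Theta_F = s_space :> set (nat -> R[i]).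
Proof.
apply/seteqP; split=> a.
  move=> Ta; apply: decay_s_space => k; exists (Theta_norm k a) => n.
  by apply: Theta_coef_le; exact: Ta.
by move=> sa k _; have [] := decay_Theta (fun n => s_coef_le k.+1 n sa).
Qed.

Lemma s_space_sub a b : s_space a -> s_space b -> s_space (a - b).
Proof.
move=> sa sb; apply: decay_s_space => k; exists (s_norm k a + s_norm k b) => n.
apply: (@le_trans _ _ ((cmod (a n) + cmod (b n)) * n.+1%:R ^+ k)).
  by rewrite ler_wpM2r ?exprn_ge0 ?cmodB.
by rewrite mulrDl lerD// s_coef_le.
Qed.

(** Where m < n, the factor (m+1)^k is absorbed into a power of n+1; where n <= m, the assumed decay
    in m cancels it. An abstract matrix [w] lets the lemma serve both decay conditions, one of them
    after transposition. *)
Lemma off_diagonal_decay (w : nat -> nat -> R) s C :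
  (forall m n, 0 <= w m n) -> 0 < C ->
  (forall m n, (m < n)%N -> w m n <= C * n.+1%:R ^+ s) ->
  (forall k, (0 < k)%N -> exists2 Ck : R, 0 < Ck & forall m n, (n <= m)%N ->
      w m n <= Ck * n.+1%:R ^+ k * m.+1%:R ^- k) ->
  forall k, exists p, exists2 D, 0 < D & forall m n,
    w m n * m.+1%:R ^+ k <= D * n.+1%:R ^+ p.
Proof.
(* The decay is assumed for positive exponents only, so [k.+1] also covers [k = 0]; the surplus
   power of m+1 is dropped at the end. *)
move=> w0 C0 up low k; have [Ck Ck0 {}low] := low k.+1 isT.
exists (s + k.+1)%N, (C + Ck); first by rewrite addr_gt0.
have n1 n i j : (i <= j)%N -> n.+1%:R ^+ i <= n.+1%:R ^+ j :> R.
  by move=> ij; rewrite ler_weXn2l// ler1n.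
move=> m n; have [mn|nm] := ltnP m n.
  apply: (@le_trans _ _ (C * n.+1%:R ^+ s * n.+1%:R ^+ k.+1)).
    apply: ler_pM; rewrite ?exprn_ge0//; first exact: up.
    rewrite (le_trans _ (n1 n _ _ (leqnSn k)))// lerXn2r ?nnegrE//.
    by rewrite ler_nat ltnS ltnW.
  rewrite -mulrA -exprD ler_wpM2r ?exprn_ge0// lerDl; exact: ltW.
have {}low := low _ _ nm.
rewrite -ler_pdivlMr ?exprn_gt0// (le_trans low)//.
have {}C0 := ltW C0; have {}Ck0 := ltW Ck0.
apply: ler_pM; rewrite ?mulr_ge0 ?invr_ge0 ?exprn_ge0//.
  by apply: ler_pM; rewrite ?exprn_ge0 ?n1 ?leq_addl ?lerDr.
by rewrite lef_pV2 ?posrE ?exprn_gt0// n1.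
Qed.

End Decay.

(** * Continuity between spaces topologized by families of seminorms *)

Section Continuity.
Context {R : realType}.

(** The bound concerns differences of values, so no linearity of [T] is required: [synthesis_op] is
    a [limn], known to respect differences only for convergent series. *)
Lemma bounded_continuous (V1 V2 : zmodType) (D1 : set V1) (p1 : nat -> V1 -> R)
    (D2 : set V2) (p2 : nat -> V2 -> R) (T : V1 -> V2) :
  (forall x, D1 x -> D2 (T x)) ->
  (forall k, exists K, exists2 C : R, 0 < C &
    forall x y, D1 x -> D1 y -> p2 k (T y - T x) <= C * p1 K (y - x)) ->
  continuous_from_into D1 p1 D2 p2 T.
Proof.
move=> TD Tb.
pose F (x : seminormed D1 p1) : seminormed D2 p2 :=
  exist _ (T (sval x)) (mem_set (TD _ (set_mem (svalP x)))).
exists F; split=> //; apply/continuousP => A oA.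
suff: seminorm_open (F @^-1` A) by [].
move=> x Ax; have [n [eps eps0 nA]] := oA _ Ax.
suff [K [d d0 dF]] : exists K, exists2 d : R, 0 < d & forall y,
    seminorm_nbh x K d y -> seminorm_nbh (F x) n eps (F y).
  by exists K, d => // y /dF/nA.
(* A basic neighbourhood constrains the seminorms up to [n]. Each new one is met by enlarging the
   source index to a maximum and shrinking the radius to a minimum. *)
elim: n {nA} => [|n [K [d d0 dF]]].
  have [K [C C0 le]] := Tb 0%N; exists K, (eps / C); first by rewrite divr_gt0.
  move=> y /(_ K (leqnn K)) yx k; rewrite leqn0 => /eqP ->.
  apply: le_lt_trans (le _ _ (set_mem (svalP x)) (set_mem (svalP y))) _.
  by rewrite mulrC -ltr_pdivlMr.
have [L [C C0 le]] := Tb n.+1.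
exists (maxn K L), (Num.min d (eps / C)).
  by rewrite lt_min d0 divr_gt0.
move=> y yx k; rewrite leq_eqVlt => /orP[/eqP ->|].
  apply: le_lt_trans (le _ _ (set_mem (svalP x)) (set_mem (svalP y))) _.
  have := yx L (leq_maxr _ _).
  by rewrite lt_min ltr_pdivlMr// mulrC => /andP[].
rewrite ltnS => kn; apply: dF => // j jK.
by have := yx j (leq_trans jK (leq_maxl _ _)); rewrite lt_min => /andP[].
Qed.

Lemma continuous_from_into_comp (V1 V2 V3 : zmodType)
    (D1 : set V1) (p1 : nat -> V1 -> R) (D2 : set V2) (p2 : nat -> V2 -> R)
    (D3 : set V3) (p3 : nat -> V3 -> R) (S : V1 -> V2) (T : V2 -> V3) :
  continuous_from_into D1 p1 D2 p2 S -> continuous_from_into D2 p2 D3 p3 T ->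
  continuous_from_into D1 p1 D3 p3 (T \o S).
Proof.
move=> [F [FS cF]] [G [GT cG]]; exists (G \o F); split=> [x|x].
  by rewrite /= GT FS.
by apply: continuous_comp; [exact: cF|exact: cG].
Qed.

End Continuity.

(** * Cauchy-Schwarz, inner products of series, and convergence of synthesis series *)

Section InnerProduct.
Context {R : realType} {H : completeNormedModType R[i]}.
Variable ip : {dot H for conjc}.
Hypothesis ip_norm : forall f : H, `|f| ^+ 2 = ip f f.
Implicit Types (f v : H) (u : nat -> H) (a : nat -> R[i]).

Lemma normr_rnorm f : `|f| = (rnorm f)%:C%C.
Proof. by rewrite /rnorm RRe_real// ger0_real. Qed.

Lemma rnorm_ge0 f : 0 <= rnorm f.
Proof. by rewrite -ler0c -normr_rnorm. Qed.

Lemma rnormD f v : rnorm (f + v) <= rnorm f + rnorm v.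
Proof. by rewrite -lecR rmorphD/= -!normr_rnorm ler_normD. Qed.

Lemma rnormZ (z : R[i]) f : rnorm (z *: f) = cmod z * rnorm f.
Proof.
apply: complexI; rewrite rmorphM/= -!normr_rnorm -normr_cmod.
exact: normrZ.
Qed.

Lemma ipC f v : ip f v = conjc (ip v f).
Proof. by rewrite hermC expr0 mul1r. Qed.

Lemma Re_ip_self f : complex.Re (ip f f) = rnorm f ^+ 2.
Proof. by rewrite -ip_norm normr_rnorm -rmorphXn. Qed.

(* Expanding |f + v|^2 turns the triangle inequality into this bound. *)
Lemma Re_ip_le f v : complex.Re (ip f v) <= rnorm f * rnorm v.
Proof.
have ReD : {morph @complex.Re R : x y / x + y}.
  by move=> [? ?] [? ?].
have fv : rnorm (f + v) ^+ 2 <= (rnorm f + rnorm v) ^+ 2.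
  by rewrite lerXn2r ?rnormD ?nnegrE ?addr_ge0 ?rnorm_ge0.
have : complex.Re (ip (f + v) (f + v)) =
    rnorm f ^+ 2 + rnorm v ^+ 2 + 2 * complex.Re (ip f v).
  rewrite hnormD !ReD !Re_ip_self expr0 mul1r.
  have -> (z : R[i]) : complex.Re (conjc z) = complex.Re z by case: z.
  by rewrite mulr_natl mulr2n.
by rewrite Re_ip_self; nra.
Qed.

(** Multiplying [f] by the conjugate of [ip f v] makes the inner product equal to its squared
    modulus, so the bound on real parts applies; one factor of the modulus then cancels. *)
Lemma cmod_ip_le f v : cmod (ip f v) <= rnorm f * rnorm v.
Proof.
have [->|z0] := eqVneq (cmod (ip f v)) 0.
  by rewrite mulr_ge0 ?rnorm_ge0.
have zgt0 : 0 < cmod (ip f v) by rewrite lt_neqAle eq_sym z0 cmod_ge0.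
rewrite -(ler_pM2l zgt0) mulrA.
have -> : cmod (ip f v) * rnorm f = rnorm (conjc (ip f v) *: f).
  by rewrite rnormZ cmodJ.
apply: le_trans (Re_ip_le _ _).
rewrite linearZl_LR /=; move: (ip f v) => [x y] /=.
by rewrite -expr2 sqr_sqrtr ?addr_ge0 ?sqr_ge0//; lra.
Qed.

Lemma cmod_ipC f v : cmod (ip f v) = cmod (ip v f).
Proof. by rewrite ipC cmodJ. Qed.

Lemma cvg_rnorm (S : nat -> H) f (eps : R) : S @ \oo --> f -> 0 < eps ->
  exists n, rnorm (f - S n) < eps.
Proof.
move=> /cvgrPdist_lt Sf e0; have := Sf eps%:C%C.
rewrite ltcR => /(_ e0) [n _ /(_ n (leqnn n)) /=].
by rewrite normr_rnorm ltcR => ?; exists n.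
Qed.

Lemma cmod_ip_lim_le (S : nat -> H) f v (B : R) : S @ \oo --> f ->
  (forall n, cmod (ip (S n) v) <= B) -> cmod (ip f v) <= B.
Proof.
move=> Sf SB; apply/ler_addgt0Pr => eps e0.
(* The added 1 keeps the divisor positive when [v] is zero. *)
have e1 : 0 < eps / (rnorm v + 1) by rewrite divr_gt0// ltr_wpDl ?rnorm_ge0.
have [n ltn] := cvg_rnorm Sf e1.
rewrite -(subrK (S n) f) linearDl addrC (le_trans (cmodD _ _))//.
rewrite lerD ?SB// (le_trans (cmod_ip_le _ _))//.
have v1 : 0 < rnorm v + 1 by rewrite ltr_wpDl ?rnorm_ge0.
move: ltn; rewrite ltr_pdivlMr// => ltn; apply: le_trans (ltW ltn).
by rewrite ler_wpM2l ?rnorm_ge0 ?lerDl.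
Qed.

Lemma ip_series u a v n :
  ip (series (fun i => a i *: u i) n) v = \sum_(0 <= i < n) a i * ip (u i) v.
Proof.
rewrite /series /= linear_sumlz; apply: eq_bigr => i _.
by rewrite linearZl_LR.
Qed.

(** The partial sums obey the bound uniformly, by [pairing_le] started at index 0, and it survives
    the limit. *)
Lemma cmod_ip_expansion_le u a f v p (B D : R) : 0 <= B -> 0 <= D ->
  series (fun i => a i *: u i) @ \oo --> f ->
  (forall i, cmod (a i) * i.+1%:R ^+ p.+2 <= B) ->
  (forall i, cmod (ip (u i) v) <= D * i.+1%:R ^+ p) ->
  cmod (ip f v) <= B * D * 2.
Proof.
move=> B0 D0 auf aB uD; apply: (cmod_ip_lim_le auf) => n.
rewrite ip_series (le_trans (pairing_le 0 n B0 D0 aB uD))//.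
by rewrite divr1.
Qed.

(** Testing the upper frame inequality on [u n] and keeping only the n-th term gives |u_n|^4 <= B
    |u_n|^2. The bound B + 1 dominates the square root of B. *)
Lemma frame_bounded u : is_frame ip u -> exists2 b : R, 0 < b &
  forall n, rnorm (u n) <= b.
Proof.
move=> [A [B [A0 B0 uB]]]; exists (B + 1) => [|n].
  exact: ltr_wpDl (ltW B0) ltr01.
have pos i : (0 <= (cmod (ip (u n) (u i)) ^+ 2)%:E)%E.
  by rewrite lee_fin sqr_ge0.
have /andP[_ le] := uB (u n).
have : ((cmod (ip (u n) (u n)) ^+ 2)%:E <= (B * rnorm (u n) ^+ 2)%:E)%E.
  apply: le_trans le.
  have := @nneseries_lim_ge _ _ predT 0%N n.+1 (fun i _ _ => pos i).
  by apply: le_trans; rewrite big_nat_recr//= leeDr// sume_ge0.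
have -> : cmod (ip (u n) (u n)) = rnorm (u n) ^+ 2.
  apply: complexI; rewrite -normr_cmod -ip_norm normrX normr_id normr_rnorm.
  by rewrite -rmorphXn.
rewrite lee_fin; have := rnorm_ge0 (u n); move: (rnorm _) => x x0 h.
rewrite leNgt; apply/negP => xB.
have x2 : 0 < x ^+ 2 by rewrite exprn_gt0// (le_lt_trans _ xB)// addr_ge0// ltW.
move: h; rewrite expr2 ler_pM2r// => h; nra.
Qed.

(** The vectors are bounded and the coefficients are O(n^(-2)), so the tails from m on are O(1/m)
    and completeness gives the limit. *)
Lemma s_series_cvg u c (b : R) : (forall n, rnorm (u n) <= b) -> s_space c ->
  cvgn (series (fun n => c n *: u n)).
Proof.
move=> ub sc; have b0 : 0 <= b by apply: le_trans (ub 0%N); exact: rnorm_ge0.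
have s0 := s_norm_ge0 2 sc.
have tail m n : rnorm (\sum_(m <= k < n) c k *: u k)
    <= s_norm 2 c * b * (2 / m.+1%:R).
  apply: (@le_trans _ _ (\sum_(m <= k < n) (s_norm 2 c * b * k.+1%:R ^- 2))).
    elim/big_ind2: _ => [|x1 x2 y1 y2 h1 h2|i _].
    - by rewrite /rnorm normr0.
    - by rewrite (le_trans (rnormD _ _))// lerD.
    - rewrite rnormZ; apply: (@decay_summand_le _ _ _ _ _ 0).
      + exact: cmod_ge0.
      + exact: rnorm_ge0.
      + exact: s_coef_le.
      + by rewrite expr0 mulr1.
  by rewrite -mulr_sumr ler_wpM2l ?mulr_ge0 ?sum_invsqr_le.
apply/cauchy_cvgP/cauchy_seriesP => eps eps0.
(* The Cauchy criterion quantifies over positive elements of [R[i]], which are real. *)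
have [epsE eps'0] : eps = (complex.Re eps)%:C%C /\ 0 < complex.Re eps.
  have E : (complex.Re eps)%:C%C = eps by rewrite RRe_real// gtr0_real.
  by split=> //; rewrite -ltcR E.
set M := s_norm 2 c * b * 2.
have M0 : 0 <= M by rewrite !mulr_ge0.
have N0 : 0 < complex.Re eps / (M + 1) by rewrite divr_gt0// ltr_wpDl.
have /= nearm := near_infty_natSinv_lt (PosNum N0).
near=> n.
rewrite epsE normr_rnorm ltcR (le_lt_trans (tail _ _))// mulrA -/M.
(* Here [n] is the pair of summation bounds. The tail estimate depends on the lower bound alone, so
   only the first component has to be large. *)
have lt : n.1.+1%:R^-1 < complex.Re eps / (M + 1).
  near: n; case: nearm => N _ h.
  exists ([set m | (N <= m)%N], setT) => /=.
    by split; [exists N|exact: filterT].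
  by move=> [m1 m2] [/= Nm _]; exact: h.
have M1 : 0 < M + 1 by rewrite ltr_wpDl.
move: lt; rewrite ltr_pdivlMr// => lt; apply: le_lt_trans lt.
by rewrite mulrC ler_wpM2l ?invr_ge0// lerDl.
Unshelve. all: by end_near. Qed.

End InnerProduct.

(** * Estimates and continuity for the analysis and synthesis operators *)

Section Operators.
Context {R : realType} {H : completeNormedModType R[i]}.
Variable ip : {dot H for conjc}.
Hypothesis ip_norm : forall f : H, `|f| ^+ 2 = ip f f.
Implicit Types (e g gd : nat -> H) (c : nat -> R[i]).

Lemma X_F_s_space gd f : X_F ip gd f <-> s_space (analysis_op ip gd f).
Proof.
rewrite -Theta_F_s_space; split=> h k _; exact: h.
Qed.

Lemma analysis_op_sub e f1 f2 :
  analysis_op ip e f1 - analysis_op ip e f2 = analysis_op ip e (f1 - f2).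
Proof. by apply/funext => n; rewrite /analysis_op/= linearBl. Qed.

Lemma X_F_sub gd f1 f2 : X_F ip gd f1 -> X_F ip gd f2 -> X_F ip gd (f1 - f2).
Proof.
move=> /X_F_s_space h1 /X_F_s_space h2; apply/X_F_s_space.
by rewrite -analysis_op_sub; exact: s_space_sub.
Qed.

Lemma analysis_op_decay g gd e :
  (forall f, series (fun n => ip f (gd n) *: g n) @ \oo --> f) ->
  analysis_decay ip g e ->
  forall k, exists K, exists2 C : R, 0 < C & forall f, X_F ip gd f -> forall m,
    cmod (analysis_op ip e f m) * m.+1%:R ^+ k <= C * X_norm ip gd K f.
Proof.
move=> gE [s [C [_ C0 up low]]] k.
have [p [D D0 {up low}le]] := off_diagonal_decay
  (fun m n => cmod_ge0 (ip (e m) (g n))) C0 up low k.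
(* The two extra powers make the paired series summable, and 2 bounds the sum of the inverse
   squares. *)
exists p.+2, (D * 2) => [|f fX m]; first by rewrite mulr_gt0.
have mk : 0 < m.+1%:R ^+ k :> R by rewrite exprn_gt0.
have coef i := Theta_coef_le i (fX p.+2 I).
have N0 : 0 <= X_norm ip gd p.+2 f by exact: sqrtr_ge0.
rewrite -ler_pdivlMr//.
have -> : D * 2 * X_norm ip gd p.+2 f / m.+1%:R ^+ k =
  X_norm ip gd p.+2 f * (D / m.+1%:R ^+ k) * 2 by ring.
apply: (cmod_ip_expansion_le ip_norm N0 _ (gE f) coef) => [|i].
  by rewrite divr_ge0// ltW.
(* Expanding [f] puts [g i] in the first slot, whereas the decay condition has [e m] there. *)
by rewrite cmod_ipC mulrAC ler_pdivlMr.
Qed.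

Lemma synthesis_op_decay gd e :
  (forall c, s_space c -> cvgn (series (fun n => c n *: e n))) ->
  synthesis_decay ip gd e ->
  forall k, exists K, exists2 C : R, 0 < C & forall c, s_space c -> forall n,
    cmod (analysis_op ip gd (synthesis_op e c) n) * n.+1%:R ^+ k
      <= C * s_norm K c.
Proof.
move=> ce [s [C [C0 up low]]] k.
(* The matrix is transposed: the output index [n] of [gd] becomes the row and the summation index
   [m] of [e] the column. *)
have [p [D D0 {up low}le]] := off_diagonal_decay
  (fun n m => cmod_ge0 (ip (e m) (gd n))) C0 (fun n m => up m n)
  (fun k k0 => let: ex_intro2 Ck Ck0 h := low k k0 in
     ex_intro2 _ _ Ck Ck0 (fun n m => h m n)) k.
exists p.+2, (D * 2) => [|c sc n]; first by rewrite mulr_gt0.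
have nk : 0 < n.+1%:R ^+ k :> R by rewrite exprn_gt0.
rewrite -ler_pdivlMr//.
have -> : D * 2 * s_norm p.+2 c / n.+1%:R ^+ k =
  s_norm p.+2 c * (D / n.+1%:R ^+ k) * 2 by ring.
apply: (cmod_ip_expansion_le ip_norm (s_norm_ge0 _ sc) _ (ce c sc)
  (fun i => s_coef_le p.+2 i sc)) => [|i].
  by rewrite divr_ge0// ltW.
by rewrite mulrAC ler_pdivlMr.
Qed.

(** Convergence is assumed because [limn] of a divergent series carries no information. *)
Lemma synthesis_op_sub e c1 c2 : cvgn (series (fun n => c1 n *: e n)) ->
  cvgn (series (fun n => c2 n *: e n)) ->
  synthesis_op e c1 - synthesis_op e c2 = synthesis_op e (c1 - c2).
Proof.
move=> h1 h2; rewrite /synthesis_op -limB//; congr (limn _).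
apply/funext => n; rewrite /series /=.
under [RHS]eq_bigr do rewrite scalerBl.
by rewrite sumrB.
Qed.

Lemma analysis_op_continuous g gd e :
  (forall f, series (fun n => ip f (gd n) *: g n) @ \oo --> f) ->
  analysis_decay ip g e ->
  continuous_from_into (X_F ip gd) (X_norm ip gd) s_space s_norm
    (analysis_op ip e).
Proof.
move=> gE he; have le := analysis_op_decay gE he.
apply: bounded_continuous => [f fX|k].
  apply: decay_s_space => k; have [K [C _ {}le]] := le k.
  by exists (C * X_norm ip gd K f); exact: le.
have [K [C C0 {}le]] := le k; exists K, C => // f1 f2 f1X f2X.
by rewrite analysis_op_sub; apply: s_norm_le; apply: le; exact: X_F_sub.
Qed.

Lemma synthesis_op_continuous gd e :
  (forall c, s_space c -> cvgn (series (fun n => c n *: e n))) ->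
  synthesis_decay ip gd e ->
  continuous_from_into s_space s_norm (X_F ip gd) (X_norm ip gd)
    (synthesis_op e).
Proof.
move=> ce he; have le := synthesis_op_decay ce he.
apply: bounded_continuous => [c sc|k].
  apply/X_F_s_space/decay_s_space => k; have [K [C _ {}le]] := le k.
  by exists (C * s_norm K c); exact: le.
(* Passing from a supremum bound to the norm of [Theta k] costs one power of the index and the
   factor 2^(k+1), as in [decay_Theta]. *)
have [K [C C0 {}le]] := le k.+1; exists K, (2 ^+ k.+1 * C).
  by rewrite mulr_gt0 ?exprn_gt0.
move=> c1 c2 sc1 sc2; rewrite synthesis_op_sub; [|exact: ce..].
have [_] := decay_Theta (le _ (s_space_sub sc2 sc1)).
by rewrite mulrA.
Qed.

End Operators.

Theorem proposition4p1 (R : realType) (H : completeNormedModType R[i])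
  (ip : {dot H for conjc})
  (ip_norm : forall f : H, `|f| ^+ 2 = ip f f)
  (H_separable : exists2 S : set H, countable S & dense S)
  (g gd : nat -> H)
  (g_frame : is_frame ip g) (gd_dual : is_dual_frame ip g gd)
  (M_nontrivial : forall k : nat, (0 < k)%N ->
     coef_range ip gd `&` Theta k <> [set 0])
  (M_dense : forall k : nat, (0 < k)%N ->
     forall a, (coef_range ip gd `&` Theta k) a ->
     forall eps : R, 0 < eps ->
     exists2 b, (coef_range ip gd `&` Theta_F) b & Theta_norm k (a - b) < eps)
  (e : nat -> H) (e_X_F : forall n, X_F ip gd (e n))
  (e_frame : is_frame ip e) :
  [/\ analysis_decay ip g e ->
        continuous_from_into (X_F ip gd) (X_norm ip gd) s_space s_norm
          (analysis_op ip e),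
      synthesis_decay ip gd e ->
        (forall c, s_space c -> cvgn (series (fun n => c n *: e n))) /\
        continuous_from_into s_space s_norm (X_F ip gd) (X_norm ip gd)
          (synthesis_op e) &
      analysis_decay ip g e -> synthesis_decay ip gd e ->
        continuous_from_into (X_F ip gd) (X_norm ip gd)
          (X_F ip gd) (X_norm ip gd) (frame_op ip e)].
Proof.
have gE f := (gd_dual.2 f).1.
have [b _ eb] := frame_bounded ip_norm e_frame.
(* This makes [synthesis_op e c] a genuine sum for every [c] in [s_space]. *)
have ce c : s_space c -> cvgn (series (fun n => c n *: e n)).
  exact: s_series_cvg eb.
split=> [ha|hs|ha hs].
- exact: analysis_op_continuous ip_norm _ _ _ gE ha.
- by split=> //; exact: synthesis_op_continuous.
(* [frame_op] unfolds to the composite of the two operators, with [s_space] in between. *)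
- apply: continuous_from_into_comp (synthesis_op_continuous ip_norm ce hs).
  exact: analysis_op_continuous ip_norm _ _ _ gE ha.
Qed.
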